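(* Let $\beta\in B$. If $J_\beta\not\equiv+\infty$ on $\mathbb R^d$, then $J_\beta^*=K_\beta$ on $\mathbb R^d$, where $J_\beta^*(\vartheta)=\sup_{a\in\mathbb R^d}[\langle\vartheta,a\rangle-J_\beta(a)]$ is the convex conjugate of $J_\beta$.
   Context: Setting. $(Z,\mathcal Z)$ is a measurable space with a $\sigma$-finite measure $\mu$, and $\varphi\colon Z\to\mathbb R^d$ is $\mathcal Z$-measurable (the moment mapping). $\Gamma$ is the class of functions $\gamma\colon\mathbb R\to(-\infty,+\infty]$ that are finite and strictly convex on $(0,+\infty)$, equal to $+\infty$ for $t<0$, and satisfy $\gamma(0)=\lim_{t\downarrow0}\gamma(t)$. $B$ is the class of functions $\beta\colon Z\times\mathbb R\to(-\infty,+\infty]$ such that $\beta(\cdot,t)$ is $\mathcal Z$-measurable for each $t\in\mathbb R$ and $\beta(z,\cdot)\in\Gamma$ for each $z\in Z$. Convention: an integral whose positive and negative parts are both infinite equals $+\infty$. $\mathcal G$ is the linear space of $\mathcal Z$-measurable $g\colon Z\to\mathbb R$ with $\varphi g$ $\mu$-integrable; $\mathcal G_a=\{g\in\mathcal G\colon\int_Z\varphi g\,d\mu=a\}$ for $a\in\mathbb R^d$; the superscript $+$ denotes the subset of nonnegative functions. The integral functional is $H_\beta(g)=\int_Z\beta(z,g(z))\,\mu(dz)$ and the value function is $J_\beta(a)=\inf_{g\in\mathcal G_a^+}H_\beta(g)$, $a\in\mathbb R^d$ ($\inf\emptyset=+\infty$). With $\beta^*(z,r)=\sup_{t\in\mathbb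 R}[rt-\beta(z,t)]$, put $K_\beta(\vartheta)=\int_Z\beta^*(z,\langle\vartheta,\varphi(z)\rangle)\,\mu(dz)$, $\vartheta\in\mathbb R^d$. *)

(* Defs.v *)
From HB Require Import structures.
From mathcomp Require Import all_boot all_order all_algebra.
From mathcomp Require Import all_classical all_reals all_analysis.
From mathcomp Require Import measurable_realfun.

Set Implicit Arguments.
Unset Strict Implicit.
Unset Printing Implicit Defensive.

Import Order.TTheory GRing.Theory Num.Theory.
Import numFieldNormedType.Exports.

Local Open Scope classical_set_scope.
Local Open Scope ring_scope.
Local Open Scope ereal_scope.

Section one_dimensional.
Context {R : realType}.

Definition Gamma (gamma : R -> \bar R) : Prop :=
  [/\ (forall t : R, gamma t != -oo),
      (forall t : R, (0 < t)%R -> gamma t \is a fin_num),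
      (forall x y s : R, (0 < x)%R -> (0 < y)%R -> x != y ->
         (0 < s)%R -> (s < 1)%R ->
         gamma (s * x + (1 - s) * y)%R
           < s%:E * gamma x + (1 - s)%:E * gamma y),
      (forall t : R, (t < 0)%R -> gamma t = +oo) &
      gamma t @[t --> 0^'+] --> gamma 0%R].

Definition conj1 (f : R -> \bar R) (r : R) : \bar R :=
  ereal_sup [set (r * t)%:E - f t | t in [set: R]].

End one_dimensional.

Section euclidean.
Context {R : realType} {n : nat}.

Definition dotv (u v : 'rV[R]_n) : R := (\sum_(i < n) u ord0 i * v ord0 i)%R.

Definition conjv (f : 'rV[R]_n -> \bar R) (theta : 'rV[R]_n) : \bar R :=
  ereal_sup [set (dotv theta a)%:E - f a | a in [set: 'rV[R]_n]].

End euclidean.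

Section integral_functionals.
Context {d : measure_display} {Z : measurableType d} {R : realType} {n : nat}.
Variable mu : {measure set Z -> \bar R}.

(* The library integral is \int f^\+ - \int f^\- with +oo - +oo = -oo; here
   the value is +oo when both parts have infinite integral. *)
Definition integral_pinfty (f : Z -> \bar R) : \bar R :=
  if \int[mu]_z f^\+ z == +oo then +oo else \int[mu]_z f z.

Definition integrand_class (beta : Z -> R -> \bar R) : Prop :=
  (forall t, measurable_fun [set: Z] (fun z => beta z t)) /\
  (forall z, Gamma (beta z)).

(* The sigma-algebra on R^n is the product one, so measurability of a
   vector-valued map is that of its coordinates. *)
Definition measurable_map (phi : Z -> 'rV[R]_n) : Prop :=
  forall i, measurable_fun [set: Z] (fun z => phi z ord0 i).

Variable phi : Z -> 'rV[R]_n.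

Definition moment_space : set (Z -> R) :=
  [set g | measurable_fun [set: Z] g /\
           forall i, mu.-integrable [set: Z]
                       (fun z => (phi z ord0 i * g z)%:E)].

Definition moment_fiber (a : 'rV[R]_n) : set (Z -> R) :=
  moment_space `&`
  [set g | forall i, \int[mu]_z (phi z ord0 i * g z)%:E = (a ord0 i)%:E].

Definition moment_fiber_nneg (a : 'rV[R]_n) : set (Z -> R) :=
  moment_fiber a `&` [set g | forall z, (0 <= g z)%R].

Definition integral_functional (beta : Z -> R -> \bar R) (g : Z -> R) : \bar R :=
  integral_pinfty (fun z => beta z (g z)).

Definition value_function (beta : Z -> R -> \bar R) (a : 'rV[R]_n) : \bar R :=
  ereal_inf (integral_functional beta @` moment_fiber_nneg a).

Definition K_function (beta : Z -> R -> \bar R) (theta : 'rV[R]_n) : \bar R :=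
  integral_pinfty (fun z => conj1 (beta z) (dotv theta (phi z))).

End integral_functionals.

(* Main.v *)
(** Taking the infimum out of the conjugate, [J^*(theta)] is the supremum over
    nonnegative [g] in the moment space of [\int gap(z, g z)], where
    [gap(z, t) = <theta, phi z> t - beta(z, t)].  Pointwise [gap <= beta^*], so
    only [K <= J^*] with [J^*(theta) < +oo] needs work.  Starting from [g0] with
    [H(g0) < +oo], enumerate pairs (positive rational [q], set [E] of finite
    measure on which [phi] is bounded) and, at each step, replace the current
    value of [g] by [q] at those points of [E] where this increases the gap.
    Each replacement stays in the moment space; since convexity makes
    [beta(z, -)] right-continuous on [0, +oo[, rationals compute [beta^*], and
    the gaps increase pointwise to [beta^*].  Monotone convergence gives the
    integrability of the positive part of [beta^*], and dominated convergence
    then bounds its integral by [J^*(theta)]. *)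

Require Import Defs.
From mathcomp Require Import all_boot all_order all_algebra.
From mathcomp Require Import all_classical all_reals all_analysis.
From mathcomp Require Import measurable_realfun lra ring.

Set Implicit Arguments.
Unset Strict Implicit.
Unset Printing Implicit Defensive.

Import Order.TTheory GRing.Theory Num.Theory.
Import numFieldNormedType.Exports.

Local Open Scope classical_set_scope.
Local Open Scope ring_scope.
Local Open Scope ereal_scope.

(** * Right-continuity of functions in the class [Gamma] *)

Section Gamma_theory.
Context {R : realType} (gamma : R -> \bar R).
Hypothesis Ggamma : Gamma gamma.

Lemma Gamma_fin_num (t : R) : (0 < t)%R -> gamma t \is a fin_num.
Proof. by case: Ggamma => _ + _ _ _; exact. Qed.

Lemma Gamma_convex (x y s : R) : (0 < x)%R -> (0 < y)%R -> x != y ->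
  (0 < s)%R -> (s < 1)%R ->
  (fine (gamma (s * x + (1 - s) * y)) <=
   s * fine (gamma x) + (1 - s) * fine (gamma y))%R.
Proof.
move=> x0 y0 xy s0 s1; case: Ggamma => _ _ /(_ x y s x0 y0 xy s0 s1) + _ _.
have c0 : (0 < s * x + (1 - s) * y)%R.
  by rewrite addr_gt0// mulr_gt0// subr_gt0.
rewrite -[gamma (s * x + _)]fineK ?Gamma_fin_num//.
rewrite -[gamma x]fineK ?Gamma_fin_num// -[gamma y]fineK ?Gamma_fin_num//.
by rewrite -!EFinM -EFinD lte_fin /= => /ltW.
Qed.

(* Convexity squeezes [gamma q], for [q] right of [t], between the secants
   through [t / 2, t] and through [t, t + 1]. *)
Lemma Gamma_cvg_at_right (t : R) : (0 <= t)%R ->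
  gamma q @[q --> t^'+] --> gamma t.
Proof.
rewrite le_eqVlt => /predU1P[<-|t0]; first by case: Ggamma.
pose G q := fine (gamma q).
have GE q : (0 < q)%R -> gamma q = (G q)%:E.
  by move=> q0; rewrite /G fineK// Gamma_fin_num.
pose sl q : R := (G t + (q - t) * ((G t - G (t / 2)) / (t / 2)))%R.
pose su q : R := (G t + (q - t) * (G (t + 1) - G t))%R.
have cvg_affine (c : R) : (G t + (q - t) * c)%:E @[q --> t^'+] --> gamma t.
  rewrite (GE t t0); apply: cvg_EFin; first by near=> q.
  rewrite (_ : _ \o _ = fun q => G t + (q - t) * c)%R//.
  rewrite -[X in _ --> X]addr0 -[X in _ --> (_ + X)%R](mul0r c).
  apply: cvgD; first exact: cvg_cst.
  apply: cvgM; last exact: cvg_cst.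
  rewrite -[X in _ --> X](subrr t); apply: cvgB; last exact: cvg_cst.
  exact: cvg_at_right_filter.
apply: (squeeze_cvge _ (cvg_affine ((G t - G (t / 2)) / (t / 2))%R)
                       (cvg_affine (G (t + 1) - G t)%R)).
near=> q.
have tq : (t < q)%R by near: q; exact: nbhs_right_gt.
have qt1 : (q < t + 1)%R by near: q; apply: nbhs_right_lt; rewrite ltrDl.
have q0 : (0 < q)%R by exact: lt_trans tq.
rewrite (GE q q0) !lee_fin; apply/andP; split.
- have h0 : (0 < q - t / 2)%R by lra.
  have th : (0 < t / 2)%R by lra.
  (* The weight is the one that makes [t] a convex combination of [q] and [t / 2]; convexity at [t],
     solved for [G q], is the lower bound [sl q]. *)
  have := @Gamma_convex q (t / 2)%R ((t / 2) / (q - t / 2))%R q0 th.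
  have -> : ((t / 2) / (q - t / 2) * q + (1 - (t / 2) / (q - t / 2)) * (t / 2)
      = t)%R by field; lra.
  rewrite -/(G _) -/(G q) -/(G (t / 2)%R) => /(_ _ _ _).
  have qn : q != (t / 2)%R by apply/eqP; lra.
  move=> /(_ qn (divr_gt0 th h0)); rewrite ltr_pdivrMr// => /(_ ltac:(lra)).
  rewrite -(ler_pM2r h0) => H.
  rewrite -(ler_pM2r th).
  have E1 : ((G t + (q - t) * ((G t - G (t / 2)) / (t / 2))) * (t / 2) =
     G t * (q - t / 2) - (q - t) * G (t / 2))%R by field; lra.
  have E2 : ((t / 2 / (q - t / 2) * G q + (1 - t / 2 / (q - t / 2)) * G (t / 2))
     * (q - t / 2) = G q * (t / 2) + (q - t) * G (t / 2))%R by field; lra.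
  by rewrite E1; rewrite E2 in H; lra.
- have t1 : (0 < t + 1)%R by lra.
  (* With weight [q - t] on [t + 1], the combination is [q] itself, which gives the upper bound
     [su q]. *)
  have := @Gamma_convex (t + 1)%R t (q - t)%R t1 t0.
  have -> : ((q - t) * (t + 1) + (1 - (q - t)) * t = q)%R by ring.
  rewrite -/(G _) -/(G t) -/(G (t + 1)%R) => /(_ ltac:(by apply/eqP; lra)).
  by move=> /(_ ltac:(lra) ltac:(lra)); lra.
Unshelve. all: by end_near. Qed.

(** By right-continuity the strict inequality persists on some interval []t, t + e[], which contains
    a rational. Staying to the right of [t] keeps that rational positive even when [t = 0]. *)
Lemma Gamma_right_approx (r t : R) (x : \bar R) : (0 <= t)%R ->
  x < (r * t)%:E - gamma t ->
  exists2 q : rat, (0 < q)%R & x < (r * ratr q)%:E - gamma (ratr q).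
Proof.
move=> t0 xt.
have cvgF : (r * q)%:E - gamma q @[q --> t^'+] --> (r * t)%:E - gamma t.
  apply: cvgeB; first exact: fin_num_adde_defr.
    apply: cvg_EFin; first by near=> q.
    by apply: cvgM; [exact: cvg_cst|exact: cvg_at_right_filter].
  exact: Gamma_cvg_at_right.
have : \forall q \near t^'+, x < (r * q)%:E - gamma q.
  apply: (cvgF [set y | x < y]); apply: open_nbhs_nbhs; split => //.
  exact: open_ereal_gt_ereal.
move=> [e /= e0 xe].
have [q] := @rat_in_itvoo R t (t + e) ltac:(by rewrite ltrDl).
rewrite in_itv/= => /andP[tq qte].
exists q; first by rewrite -(@ltr0q R) (le_lt_trans t0).
by apply: xe => //=; rewrite ltr_distlC; apply/andP; split => //; lra.
Unshelve. all: by end_near. Qed.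
End Gamma_theory.

(** * Measurability of [beta z (g z)] *)

Section Gamma_integrand.
Context {d : measure_display} {Z : measurableType d} {R : realType}.

(** The cells where [k <= h z < k + 1] form a countable measurable partition, and on each one the
    function is a single [F k]. *)
Lemma measurable_fun_comp_truncn (h : Z -> R) (F : nat -> Z -> \bar R) :
  measurable_fun [set: Z] h -> (forall z, 0 <= h z)%R ->
  (forall k, measurable_fun [set: Z] (F k)) ->
  measurable_fun [set: Z] (fun z => F (Num.truncn (h z)) z).
Proof.
move=> mh h0 mF _ Y mY; rewrite setTI.
rewrite [X in measurable X](_ : _ =
  \bigcup_k (h @^-1` `[k%:R, k.+1%:R[ `&` F k @^-1` Y)); last first.
  apply/seteqP; split=> z /=.
    by move=> Yz; exists (Num.truncn (h z)) => //; split=> //=;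
      rewrite in_itv/= truncn_itv.
  move=> [k _ [/=]]; rewrite in_itv/= => hk.
  by rewrite (truncn_def hk).
apply: bigcup_measurable => k _; apply: measurableI.
- by rewrite -[X in measurable X]setTI; exact: mh.
- by rewrite -[X in measurable X]setTI; exact: mF.
Qed.

(** Measurability of [beta] is given only at fixed [t], so [g] is approximated from above by
    functions with values in a countable grid, and right-continuity passes to the limit. *)
Lemma measurable_integrand (beta : Z -> R -> \bar R) (g : Z -> R) :
  integrand_class beta -> measurable_fun [set: Z] g -> (forall z, 0 <= g z)%R ->
  measurable_fun [set: Z] (fun z => beta z (g z)).
Proof.
move=> [mbeta Gbeta] mg g0.
(* Rounding up to the next multiple of [1 / (n + 1)]: the successor of the truncation makes [u n z]
   strictly larger than [g z], so the convergence takes place in the filter [(g z)^'+]. *)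
pose u n z : R := ((Num.truncn (n.+1%:R * g z)).+1%:R / n.+1%:R)%R.
apply: (@emeasurable_fun_cvg _ _ _ _ (fun n z => beta z (u n z))).
  move=> n; apply: (@measurable_fun_comp_truncn (fun z => n.+1%:R * g z)%R
    (fun k z => beta z (k.+1%:R / n.+1%:R)%R)) => //.
    by apply: measurable_funM => //; exact: measurable_cst.
  by move=> z; rewrite mulr_ge0.
move=> z _.
have u_gt n : (g z < u n z)%R.
  rewrite /u ltr_pdivlMr// mulrC.
  by have /andP[] := @truncn_itv R (n.+1%:R * g z) (mulr_ge0 (ler0n _ _) (g0 z)).
have u_le n : (u n z <= g z + n.+1%:R^-1)%R.
  rewrite /u ler_pdivrMr// mulrDl mulVf// [(g z * _)%R]mulrC -addn1 natrD.
  rewrite lerD2r.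
  by have /andP[] := @truncn_itv R (n.+1%:R * g z) (mulr_ge0 (ler0n _ _) (g0 z)).
have cvg_u : u n z @[n --> \oo] --> g z.
  apply: (@squeeze_cvgr _ _ _ _ (cst (g z)) (fun n => g z + n.+1%:R^-1)%R).
  - by near=> n; rewrite u_le ltW// u_gt.
  - exact: cvg_cst.
  - rewrite -[X in _ --> X]addr0; apply: cvgD; first exact: cvg_cst.
    exact: cvg_harmonic.
have cvg_u_right : u n z @[n --> \oo] --> (g z)^'+.
  move=> A gA.
  have : \forall n \near \oo, (g z < u n z)%R -> A (u n z) by exact: cvg_u _ gA.
  by apply: filterS => n; apply; exact: u_gt.
apply: cvg_comp cvg_u_right _; exact: Gamma_cvg_at_right (Gbeta z) _ (g0 z).
Unshelve. all: by end_near. Qed.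

End Gamma_integrand.

(** * Extended-real inequalities and integrability criteria *)

Lemma leBEFin_swap {R : realDomainType} (r : R) (x y : \bar R) :
  (r%:E - x <= y) = (r%:E - y <= x).
Proof.
by case: x y => [x||] [y||]//=; rewrite ?leNye ?leey// -!EFinB !lee_fin; lra.
Qed.

Lemma le_EFinB_swap {R : realDomainType} (r : R) (x y : \bar R) :
  (x <= r%:E - y) = (y <= r%:E - x).
Proof.
by case: x y => [x||] [y||]//=; rewrite ?leNye ?leey// -!EFinB !lee_fin; lra.
Qed.

Lemma lee_abs_between {R : realDomainType} (l x u : \bar R) :
  l <= x -> x <= u -> `|x| <= `|l| + `|u|.
Proof.
move=> lx xu; have [x0|x0] := leP 0 x.
  by rewrite (gee0_abs x0) (le_trans xu)// (le_trans (lee_abs _))// leeDr.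
rewrite (lte0_abs x0) (@le_trans _ _ (- l)) ?leeN2//.
by rewrite (le_trans (lee_abs _))// abseN leeDl.
Qed.

Lemma le_funepos {T : Type} {R : realDomainType} (f : T -> \bar R) x :
  f x <= f^\+ x.
Proof. by rewrite funeposE le_max lexx. Qed.

Lemma funepos_homo {S T : Type} {R : realDomainType} (f : S -> \bar R)
  (g : T -> \bar R) x y : f x <= g y -> f^\+ x <= g^\+ y.
Proof. by move=> fg; rewrite !funeposE ge_max !le_max fg lexx orbT. Qed.

Section integrability.
Context {d : measure_display} {T : measurableType d} {R : realType}.
Variable mu : {measure set T -> \bar R}.

Lemma integrable_between (l f u : T -> \bar R) :
  mu.-integrable [set: T] l -> mu.-integrable [set: T] u ->
  measurable_fun [set: T] f -> (forall z, l z <= f z) ->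
  (forall z, f z <= u z) -> mu.-integrable [set: T] f.
Proof.
move=> il iu mf lf fu.
apply: (@le_integrable _ _ _ mu _ measurableT _ (fun z => `|l z| + `|u z|)) => //.
  move=> z _; rewrite [leRHS]gee0_abs ?adde_ge0//.
  exact: lee_abs_between (lf z) (fu z).
by apply: integrableD => //; exact: integrable_abse.
Qed.

Lemma integrable_of_funepos (f : T -> \bar R) : measurable_fun [set: T] f ->
  \int[mu]_z f^\+ z != +oo -> mu.-integrable [set: T] f^\+.
Proof.
move=> mf fpos; apply/integrableP; split; first exact: measurable_funepos.
under eq_integral do rewrite gee0_abs//.
by rewrite ltey.
Qed.

Lemma integral_pinfty_integrable (f : T -> \bar R) :
  mu.-integrable [set: T] f -> integral_pinfty mu f = \int[mu]_z f z.
Proof.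
move=> intf; rewrite /integral_pinfty ifN//.
by rewrite -ltey integral_funepos_lt_pinfty.
Qed.

(** A negative part of infinite integral, subtracted from a positive part of finite integral, would
    make the integral [-oo]. *)
Lemma integrable_of_integral_gtNy (f : T -> \bar R) :
  measurable_fun [set: T] f -> mu.-integrable [set: T] f^\+ ->
  -oo < \int[mu]_z f z -> mu.-integrable [set: T] f.
Proof.
move=> mf intfp fNy.
have intfn : mu.-integrable [set: T] f^\-.
  apply/integrableP; split; first exact: measurable_funeneg.
  under eq_integral do rewrite gee0_abs//.
  rewrite ltey; apply: contraTneq fNy => fn.
  have fin_fp : \int[mu]_z f^\+ z \is a fin_num by exact: integrable_fin_num.
  by rewrite integralE fn addeNy ltxx.
by rewrite (funeposneg f); exact: integrableB.
Qed.

Lemma integrable_indic_fin (A : set T) : measurable A -> mu A < +oo ->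
  mu.-integrable [set: T] (fun z => (\1_A z)%:E).
Proof.
move=> mA Afin; apply/integrableP; split.
  by apply/measurable_EFinP; exact: measurable_indic.
under eq_integral do rewrite gee0_abs ?lee_fin//.
by rewrite integral_indic// setIT.
Qed.

End integrability.

(** * The one-dimensional conjugate through positive rationals *)

Section conj1_theory.
Context {R : realType}.

Lemma conj1_ge (f : R -> \bar R) (r t : R) : (r * t)%:E - f t <= conj1 f r.
Proof. by apply: ereal_sup_ubound; exists t. Qed.

(** A near-optimal [t] cannot be negative, since [gamma] is [+oo] there; it can then be moved to a
    positive rational on its right. *)
Lemma conj1_rat_gt (gamma : R -> \bar R) (r : R) (x : \bar R) : Gamma gamma ->
  x < conj1 gamma r ->
  exists2 q : rat, (0 < q)%R & x < (r * ratr q)%:E - gamma (ratr q).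
Proof.
move=> Ggamma /ereal_sup_gt[_ [t _ <-] xt].
have [t0|t0] := leP 0%R t; first exact: Gamma_right_approx xt.
have [_ _ _ /(_ _ t0) gt _] := Ggamma.
by move: xt; rewrite gt /= ltNge leNye.
Qed.

End conj1_theory.

(** * Greedy pointwise maximisation *)

Section greedy.
Context {d : measure_display} {Z : measurableType d} {R : realType}.
Variables (F : Z -> R -> \bar R) (q : nat -> R) (E : nat -> set Z) (g0 : Z -> R).

(** For fixed [z], [F z (greedy k z)] is the running maximum of [F z (g0 z)] and of the [F z (q j)]
    with [j < k] and [z] in [E j]. *)
Fixpoint greedy (k : nat) (z : Z) : R :=
  if k is k'.+1 then
    if (z \in E k') && (F z (greedy k' z) < F z (q k')) then q k' else greedy k' z
  else g0 z.

Lemma greedy_ge0 : (forall z, 0 <= g0 z)%R -> (forall k, 0 < q k)%R ->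
  forall k z, (0 <= greedy k z)%R.
Proof.
by move=> g00 q0; elim=> [|k IH] z //=; case: ifPn => // _; exact: ltW.
Qed.

Lemma greedy_homo z : {homo (fun k => F z (greedy k z)) : m n / (m <= n)%N >-> m <= n}.
Proof.
apply: homo_leq => [x||k /=]; [exact: lexx|exact: le_trans|].
by case: ifPn => // /andP[_ /ltW].
Qed.

Lemma greedy_ge k z : E k z -> F z (q k) <= F z (greedy k.+1 z).
Proof.
by move=> Ez; rewrite /= mem_set//=; case: ltP.
Qed.

Lemma measurable_greedy :
  (forall g : Z -> R, measurable_fun [set: Z] g -> (forall z, 0 <= g z)%R ->
     measurable_fun [set: Z] (fun z => F z (g z))) ->
  measurable_fun [set: Z] g0 -> (forall z, 0 <= g0 z)%R ->
  (forall k, 0 < q k)%R -> (forall k, measurable (E k)) ->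
  forall k, measurable_fun [set: Z] (greedy k).
Proof.
move=> mF mg0 g00 q0 mE; elim=> [//|k IH] /=.
apply: measurable_fun_ifT => //; apply: measurable_and.
  apply: (measurable_fun_bool true); rewrite setTI.
  rewrite [X in measurable X](_ : _ = E k)//.
  by apply/seteqP; split=> z /=; [move=> /set_mem|move=> /mem_set].
apply: measurable_fun_lte; first by apply: mF => //; exact: greedy_ge0.
by apply: mF => // z; exact: ltW.
Qed.

End greedy.

(** * The moment space and its local modifications *)

Section moments.
Context {d : measure_display} {Z : measurableType d} {R : realType} {n : nat}.
Variables (mu : {sigma_finite_measure set Z -> \bar R}) (phi : Z -> 'rV[R]_n).
Hypothesis mphi : measurable_map phi.
Implicit Types (theta : 'rV[R]_n) (g : Z -> R).

Lemma measurable_dotv theta : measurable_fun [set: Z] (fun z => dotv theta (phi z)).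
Proof.
by apply: measurable_sum => i; exact: measurable_funM.
Qed.

Lemma dotv_mulE theta g z : (dotv theta (phi z) * g z)%:E =
  \sum_(i < n) (theta ord0 i)%:E * (phi z ord0 i * g z)%:E.
Proof.
rewrite sumEFin mulr_suml; congr EFin.
by apply: eq_bigr => i _; rewrite mulrA.
Qed.

Lemma integrable_dotv theta g : moment_space mu phi g ->
  mu.-integrable [set: Z] (fun z => (dotv theta (phi z) * g z)%:E).
Proof.
move=> [mg ig].
rewrite (_ : (fun z => _) = fun z => \sum_(i < n) (theta ord0 i)%:E *
  (phi z ord0 i * g z)%:E); last by apply/funext => z; exact: dotv_mulE.
by apply: integrable_sum => // i _; exact: integrableZl.
Qed.

Lemma integral_dotv theta a g : moment_fiber mu phi a g ->
  \int[mu]_z (dotv theta (phi z) * g z)%:E = (dotv theta a)%:E.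
Proof.
move=> [[mg ig] ga].
under eq_integral do rewrite dotv_mulE.
rewrite integral_sum//; last by move=> i; exact: integrableZl.
rewrite -sumEFin; apply: eq_bigr => i _.
by rewrite integralZl// ga.
Qed.

Lemma moment_space_fiber g : moment_space mu phi g ->
  exists a, moment_fiber mu phi a g.
Proof.
move=> sg; have [mg ig] := sg.
exists (\row_i fine (\int[mu]_z (phi z ord0 i * g z)%:E))%R; split=> // i.
by rewrite mxE fineK// integrable_fin_num.
Qed.

(** Where [g'] differs from [g], the point is in [E] and each coordinate of [phi g'] is at most
    [C * q] in absolute value, which is integrable over a set of finite measure. *)
Lemma moment_space_modify g g' (E : set Z) (C q : R) :
  moment_space mu phi g -> measurable_fun [set: Z] g' ->
  measurable E -> mu E < +oo -> (forall z i, E z -> `|phi z ord0 i| <= C)%R ->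
  (0 <= q)%R -> (forall z, g' z = g z \/ E z /\ g' z = q) ->
  moment_space mu phi g'.
Proof.
move=> [mg ig] mg' mE Efin EC q0 gg'; split=> // i.
have ic : mu.-integrable [set: Z] (fun z => (C * q)%:E * (\1_E z)%:E).
  by apply: integrableZl => //; exact: integrable_indic_fin.
apply: (@le_integrable _ _ _ mu _ measurableT _
  (fun z => `|(phi z ord0 i * g z)%:E| + `|(C * q)%:E * (\1_E z)%:E|)).
- by apply/measurable_EFinP; apply: measurable_funM => //; exact: mphi.
- move=> z _; rewrite [leRHS]gee0_abs ?adde_ge0//.
  case: (gg' z) => [->|[Ez ->]]; first by rewrite leeDl.
  apply: (@le_trans _ _ `|(C * q)%:E * (\1_E z)%:E|); last by rewrite leeDr.
  rewrite indicE mem_set// mule1 !abse_EFin lee_fin !normrM (ger0_norm q0).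
  by rewrite ler_wpM2r// (le_trans (EC z i Ez))// ler_norm.
- by apply: integrableD => //; apply: integrable_abse => //; exact: ig.
Qed.

(** The sets are the pieces of a sigma-finite cover cut by the sublevels of the sum of the
    [|phi_i|]; triples (rational, piece, level) are countable, hence enumerated by [unpickle]. *)
Lemma rational_bounded_cover : exists (q : nat -> R) (E : nat -> set Z),
  [/\ forall k, (0 < q k)%R,
      forall k, measurable (E k) /\ mu (E k) < +oo,
      forall k, exists C : R, forall z i, E k z -> (`|phi z ord0 i| <= C)%R &
      forall (x : rat) z, (0 < x)%R -> exists2 k, q k = ratr x & E k z].
Proof.
have [F FT Ffin] := sigma_finiteT mu.
pose B (l : nat) := [set z | \sum_(i < n) `|phi z ord0 i| <= l%:R]%R.
have mB l : measurable (B l).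
  have mS : measurable_fun [set: Z] (fun z => \sum_(i < n) `|phi z ord0 i|)%R.
    by apply: measurable_sum => i; apply: measurableT_comp => //; exact: mphi.
  rewrite (_ : B l = (fun z => \sum_(i < n) `|phi z ord0 i|)%R @^-1` `]-oo, l%:R]).
    by rewrite -[X in measurable X]setTI; exact: mS.
  by apply/seteqP; split=> z /=; rewrite in_itv.
(* Integers that code no triple fall back on [(1, 0, 0)], and nonpositive rationals are replaced by
   [1], so that every [q k] is positive. *)
pose code (k : nat) : rat * nat * nat := odflt (1%R, 0%N, 0%N) (unpickle k).
pose q k : R := if (0 < (code k).1.1)%R then ratr (code k).1.1 else 1%R.
exists q, (fun k => F (code k).1.2 `&` B (code k).2); split=> [k|k|k|x z x0].
- by rewrite /q; case: ifPn => //; rewrite ltr0q.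
- have [mF Fk] := Ffin (code k).1.2; split; first exact: measurableI.
  apply: le_lt_trans Fk; apply: le_measure; rewrite ?inE//.
    exact: measurableI.
- exists (code k).2%:R%R => z i [_]; apply: le_trans.
  by rewrite (bigD1 i)//= lerDl sumr_ge0.
- have [j _ Fj] : (\bigcup_j F j) z by rewrite -FT.
  exists (pickle (x, j, (Num.truncn (\sum_(i < n) `|phi z ord0 i|)%R).+1));
    rewrite /q /code pickleK/= ?x0//; split=> //.
  by rewrite /B /= ltW// truncnS_gt.
Qed.

End moments.

(** * Comparison of the conjugate of the value function with [K_function] *)

Section duality.
Context {d : measure_display} {Z : measurableType d} {R : realType} {n : nat}.
Variables (mu : {sigma_finite_measure set Z -> \bar R}) (phi : Z -> 'rV[R]_n).
Hypothesis mphi : measurable_map phi.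
Variable beta : Z -> R -> \bar R.
Hypothesis hbeta : integrand_class beta.
Variable theta : 'rV[R]_n.

Let r z := dotv theta (phi z).
Let gap z t := (r z * t)%:E - beta z t.
Let bconj z := conj1 (beta z) (r z).
Let J := value_function mu phi beta.
Let H := integral_functional mu beta.

Let measurable_gap (g : Z -> R) : measurable_fun [set: Z] g ->
  (forall z, 0 <= g z)%R -> measurable_fun [set: Z] (fun z => gap z (g z)).
Proof.
move=> mg g0; apply: emeasurable_funB; last exact: measurable_integrand.
by apply/measurable_EFinP; apply: measurable_funM => //; exact: measurable_dotv.
Qed.

(** The gaps increase to their supremum [s]. Were [s < bconj z], some positive rational would have
    gap above [s]; it is offered at a step [k] with [z] in [E k], after which the greedy gap is at
    least as large. *)
Let gap_greedy_cvg (q : nat -> R) (E : nat -> set Z) (g0 : Z -> R) z :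
  (forall x : rat, (0 < x)%R -> exists2 k, q k = ratr x & E k z) ->
  gap z (greedy gap q E g0 k z) @[k --> \oo] --> bconj z.
Proof.
move=> cover.
have := ereal_nondecreasing_cvgn (greedy_homo gap q E g0 z).
set s := ereal_sup _; suff -> : bconj z = s by [].
apply/eqP; rewrite eq_le; apply/andP; split; last first.
  by apply: ge_ereal_sup => _ [k _ <-]; exact: conj1_ge.
rewrite leNgt; apply/negP => /(conj1_rat_gt (hbeta.2 z))[x x0].
have [k <- Ekz] := cover x x0.
rewrite ltNge => /negP; apply; apply: le_trans (greedy_ge gap q g0 Ekz) _.
by apply: ereal_sup_ubound; exists k.+1.
Qed.

(** A supremum over uncountably many [t] becomes a sequential limit of measurable gaps, with the
    greedy process started at [0]. *)
Let measurable_bconj : measurable_fun [set: Z] bconj.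
Proof.
have [q [E [q0 mE _ cover]]] := rational_bounded_cover mu mphi.
apply: (@emeasurable_fun_cvg _ _ _ _
  (fun k z => gap z (greedy gap q E (cst 0%R) k z))) => [k|z _].
  apply: measurable_gap; last exact: greedy_ge0.
  by apply: measurable_greedy => // j; have [] := mE j.
by apply: gap_greedy_cvg => x; exact: cover.
Qed.

Lemma conjv_value_function_ge a g : moment_fiber_nneg mu phi a g ->
  (dotv theta a)%:E - H g <= conjv J theta.
Proof.
move=> ag; apply: (@le_trans _ _ ((dotv theta a)%:E - J a)).
  by rewrite leeB// ereal_inf_lbound//; exists g.
by apply: ereal_sup_ubound; exists a.
Qed.

Lemma conjv_value_function_le (c : \bar R) :
  (forall a g, moment_fiber_nneg mu phi a g -> (dotv theta a)%:E - H g <= c) ->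
  conjv J theta <= c.
Proof.
move=> Hc; apply: ge_ereal_sup => _ [a _ <-].
rewrite leBEFin_swap; apply: le_ereal_inf_tmp => _ [g ag <-].
by rewrite leBEFin_swap; exact: Hc.
Qed.

(** This integrates the pointwise Fenchel-Young inequality [gap z (g z) <= bconj z]. An infinite
    positive part of either integrand settles the claim by the [+oo] convention; otherwise both
    sides are integrable. *)
Lemma K_function_ge a g : moment_fiber_nneg mu phi a g ->
  (dotv theta a)%:E - H g <= K_function mu phi beta theta.
Proof.
move=> [ag g0].
rewrite /H /integral_functional /K_function {1}/integral_pinfty.
case: ifPn => [_|/(integrable_of_funepos _)]; first by rewrite addeNy leNye.
have mf : measurable_fun [set: Z] (fun z => beta z (g z)).
  by apply: measurable_integrand => //; exact: ag.1.1.
move=> /(_ mf) ifp.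
have [Kp|/(integrable_of_funepos measurable_bconj) iKp] :=
  eqVneq (\int[mu]_z bconj^\+ z) +oo.
  by rewrite /integral_pinfty Kp eqxx leey.
have ih : mu.-integrable [set: Z] (fun z => (r z * g z)%:E).
  exact: integrable_dotv ag.1.
have iff : mu.-integrable [set: Z] (fun z => beta z (g z)).
  (* Fenchel-Young also bounds [beta z (g z)] below, by [r z * g z] minus the positive part of
     [bconj]. *)
  apply: (integrable_between (integrableB measurableT ih iKp) ifp mf) => z.
    rewrite leBEFin_swap.
    exact: le_trans (conj1_ge _ _ _) (le_funepos (fun z => conj1 (beta z) (r z)) z).
  exact: (le_funepos (fun z => beta z (g z))).
have igap := integrableB measurableT ih iff.
have ibconj : mu.-integrable [set: Z] bconj.
  apply: (integrable_between igap iKp measurable_bconj) => z.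
    exact: conj1_ge.
  exact: le_funepos.
rewrite integral_pinfty_integrable// -(integral_dotv theta ag) -integralB//.
by apply: le_integral => // z _; exact: conj1_ge.
Qed.

(** * The reverse inequality when the conjugate is finite or [-oo] *)

Section finite_conjugate.
Hypothesis Jfin : conjv J theta < +oo.

(** The bound [u] controls the positive part of [beta z (g z)], and [Jfin] excludes the integral
    [-oo]. The integral of the gap is then [dotv theta a - H g]. *)
Lemma integrable_gap a g (u : Z -> \bar R) : moment_fiber_nneg mu phi a g ->
  mu.-integrable [set: Z] u -> (forall z, beta z (g z) <= u z) ->
  mu.-integrable [set: Z] (fun z => gap z (g z)) /\
  \int[mu]_z gap z (g z) <= conjv J theta.
Proof.
move=> ag iu fu; have [[sg _] g0] := ag.
have mf : measurable_fun [set: Z] (fun z => beta z (g z)).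
  by apply: measurable_integrand => //; exact: sg.1.
have ifp : mu.-integrable [set: Z] (fun z => beta z (g z))^\+.
  apply: (integrable_between (integrable0 mu setT)
    (integrable_funepos measurableT iu)) => [|z|z].
  - exact: measurable_funepos.
  - exact: funepos_ge0.
  - exact: (funepos_homo (f := fun z => beta z (g z))).
have := conjv_value_function_ge ag.
rewrite /H /integral_functional /integral_pinfty ifN; last first.
  by rewrite -ltey ltey_eq integrable_fin_num.
rewrite -(integral_dotv theta ag.1) => leJ.
have ih : mu.-integrable [set: Z] (fun z => (r z * g z)%:E).
  exact: integrable_dotv sg.
have iff : mu.-integrable [set: Z] (fun z => beta z (g z)).
  apply: integrable_of_integral_gtNy => //; rewrite ltNye; apply/eqP => fNy.
  have := le_lt_trans leJ Jfin; rewrite fNy /= addey//.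
  by rewrite -ltNye ltNye_eq integrable_fin_num.
by split; [exact: integrableB|rewrite integralB].
Qed.

Lemma K_function_le : (exists a, J a != +oo) ->
  K_function mu phi beta theta <= conjv J theta.
Proof.
move=> [a0]; rewrite -ltey => /ereal_inf_lt[_ [g0 ag0 <-]] Hg0.
have [q [E [q0 mE bE cover]]] := rational_bounded_cover mu mphi.
pose g := greedy gap q E g0.
have g_ge0 k z : (0 <= g k z)%R by apply: greedy_ge0 => //; exact: ag0.2.
have mg k : measurable_fun [set: Z] (g k).
  apply: measurable_greedy => //.
  - exact: ag0.1.1.1.
  - exact: ag0.2.
  - by move=> j; exact: (mE j).1.
have sg k : moment_space mu phi (g k).
  elim: k => [|k IH]; first exact: ag0.1.1.
  have [C EC] := bE k.
  apply: (moment_space_modify mphi IH (mg k.+1) (mE k).1 (mE k).2 EC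
    (ltW (q0 k))) => z.
  rewrite /g /=; case: ifPn => [/andP[/set_mem Ez _]|_]; [by right|by left].
pose M k z := gap z (g k z).
have M0M k z : M 0%N z <= M k z by exact: greedy_homo.
have Mbconj k z : M k z <= bconj z by exact: conj1_ge.
have mM k : measurable_fun [set: Z] (M k) by exact: measurable_gap.
have [iM0 _] : mu.-integrable [set: Z] (M 0%N) /\
    \int[mu]_z M 0%N z <= conjv J theta.
  apply: (integrable_gap (u := (fun z => beta z (g0 z))^\+) ag0) => [|z].
    apply: integrable_of_funepos; last first.
      move: Hg0; rewrite /integral_functional /integral_pinfty.
      by case: ifPn => // _; rewrite ltxx.
    apply: measurable_integrand => //; [exact: ag0.1.1.1|exact: ag0.2].
  exact: (le_funepos (fun z => beta z (g0 z))).
(* From [M 0 <= M k], the integrable function [r z * g k z - M 0 z] bounds [beta z (g k z)] above,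
   as [integrable_gap] requires. *)
have iM k : mu.-integrable [set: Z] (M k) /\ \int[mu]_z M k z <= conjv J theta.
  have [a ga] := moment_space_fiber (sg k).
  have ih : mu.-integrable [set: Z] (fun z => (r z * g k z)%:E).
    exact: integrable_dotv (sg k).
  apply: (integrable_gap (a := a) (conj ga (g_ge0 k))
    (integrableB measurableT ih iM0)) => z.
  by rewrite le_EFinB_swap; exact: M0M.
have iM0n := integrable_funeneg measurableT iM0.
(* The bound is uniform in [k] because the negative parts of the increasing [M k] never exceed that
   of [M 0]. *)
have le_intMp k : \int[mu]_z (M k)^\+ z <= conjv J theta + \int[mu]_z (M 0%N)^\- z.
  have [iMk Mk_le] := iM k.
  have iMkn := integrable_funeneg measurableT iMk.
  move: Mk_le; rewrite integralE leeBlDr ?integrable_fin_num// => /le_trans; apply.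
  rewrite leeD2l//; apply: le_integral => // z _.
  by rewrite -!funeposN; apply: funepos_homo; rewrite leeN2 M0M.
have iMbp : mu.-integrable [set: Z] bconj^\+.
  apply: integrable_of_funepos => //; rewrite -ltey.
  have ndMp z : [set: Z] z -> {homo (fun k => (M k)^\+ z) : k l / (k <= l)%N >-> k <= l}.
    move=> _ k l kl; apply: funepos_homo.
    exact: (greedy_homo gap q E g0 z kl).
  have mMp k : measurable_fun [set: Z] (M k)^\+ by exact: measurable_funepos.
  have cvgI := cvg_monotone_convergence (mu := mu) measurableT mMp
     (fun k z _ => funepos_ge0 (M k) z) ndMp.
  apply: (@le_lt_trans _ _ (\int[mu]_z limn (fun k => (M k)^\+ z))).
    apply: ge0_le_integral => //.
    - exact: measurable_funepos.
    - apply: (emeasurable_fun_cvg _ _ mMp) => z _.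
      exact: ereal_nondecreasing_is_cvgn (ndMp z I).
    - move=> z _; have cMp := ereal_nondecreasing_is_cvgn (ndMp z I).
      rewrite funeposE ge_max; apply/andP; split.
        have cz x : (0 < x)%R -> _ := cover x z.
        apply: (lee_cvg_to (gap_greedy_cvg g0 cz) cMp).
        by apply: nearW => k; exact: le_funepos.
      by apply: lime_ge => //; apply: nearW => k; exact: funepos_ge0.
  rewrite -(cvg_lim _ cvgI)//.
  apply: (@le_lt_trans _ _ (conjv J theta + \int[mu]_z (M 0%N)^\- z)).
    by apply: lime_le; [exact: cvgP cvgI|exact: nearW].
  by rewrite lte_add_pinfty// integral_funeneg_lt_pinfty.
(* Domination follows from [M 0 <= M k <= bconj], the last being at most its positive part, now
   known to be integrable. *)
have dom z k : `|M k z| <= `|M 0%N z| + `|bconj^\+ z|.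
  apply: lee_abs_between => //; apply: le_trans (Mbconj k z) _.
  exact: le_funepos.
have iG : mu.-integrable [set: Z] (fun z => `|M 0%N z| + `|bconj^\+ z|).
  by apply: integrableD => //; exact: integrable_abse.
have cvgMbconj : {ae mu, forall z, [set: Z] z -> M k z @[k --> \oo] --> bconj z}.
  by apply: aeW => z _; apply: gap_greedy_cvg => x; exact: cover.
have dom_ae : {ae mu, forall z, forall k, [set: Z] z ->
    `|M k z| <= `|M 0%N z| + `|bconj^\+ z|} by apply: aeW => z k _.
have [ibconj _ cvgM] := dominated_convergence measurableT mM measurable_bconj
  cvgMbconj iG dom_ae.
rewrite /K_function integral_pinfty_integrable// -(cvg_lim _ cvgM)//.
by apply: lime_le; [exact: cvgP cvgM|apply: nearW => k; exact: (iM k).2].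
Qed.
End finite_conjugate.

End duality.

Theorem theorem1p1 (R : realType) (d : measure_display) (Z : measurableType d)
    (mu : {sigma_finite_measure set Z -> \bar R}) (n : nat)
    (phi : Z -> 'rV[R]_n) (hphi : measurable_map phi)
    (beta : Z -> R -> \bar R) (hbeta : integrand_class beta) :
  (exists a : 'rV[R]_n, value_function mu phi beta a != +oo) ->
  forall theta : 'rV[R]_n,
    conjv (value_function mu phi beta) theta = K_function mu phi beta theta.
Proof.
move=> finJ theta; apply/eqP; rewrite eq_le; apply/andP; split.
  by apply: conjv_value_function_le => a g; exact: K_function_ge.
have [->|] := eqVneq (conjv (value_function mu phi beta) theta) +oo.
  exact: leey.
by rewrite -ltey => /K_function_le; exact.
Qed.
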